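(* As formal power series in $q$, $$\sum_{\pi\in\mathcal{G}\mathcal{G}_2} \omega_2(\pi)\, q^{|\pi|} = \sum_{\pi\in\mathcal{P}_{rdo}} q^{|\pi|} = \sum_{\pi\in\mathcal{A}} q^{|\pi|},$$ where the sets of partitions $\mathcal{G}\mathcal{G}_2$, $\mathcal{P}_{rdo}$, $\mathcal{A}$ and the weight $\omega_2$ are as defined in the context.
   Context: A partition $\pi=(\lambda_1,\lambda_2,\dots,\lambda_{\nu(\pi)})$ is a finite non-increasing sequence of positive integers (its parts); $\nu(\pi)$ is the number of parts and $|\pi|$ is the sum of the parts. The empty sequence is the unique partition of $0$. In frequency notation $\pi=(1^{f_1},2^{f_2},\dots)$, $f_i$ is the number of occurrences of $i$ as a part of $\pi$. $\mathcal{G}\mathcal{G}_2$ is the set of partitions into parts $\geq 3$ such that the difference between any two consecutive parts is $\geq 2$ and no two consecutive even numbers (i.e. $2k$ and $2k+2$) both appear as parts. Weight: let $\delta_{n,e}=1$ if $n$ is even and $0$ otherwise, and set $\lambda_{\nu(\pi)+1}:=0$ (so $\delta_{\lambda_{\nu(\pi)+1},e}=1$). Then $$\omega_2(\pi):=\prod_{i=1}^{\nu(\pi)} \frac{\lambda_i-\lambda_{i+1}-\delta_{\lambda_i,e}-\delta_{\lambda_{i+1},e}}{2},$$ with the empty product equal to $1$ (weight of the empty partition). $\mathcal{P}_{rdo}$ is the set of partitions in which odd parts are distinct (even parts may repeat), the smallest part is $>1$ (the empty partition is included), and, if the smallest part is $2$, then for some positive integer $j$ the partition $\pi$ starts in one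 of the following two ways: (1) $\pi=(2^{f_2},4^{f_4},6^{f_6},\dots,(4j-2)^{f_{4j-2}},(4j-1)^1,\dots)$ with $f_2,f_4,\dots,f_{4j-2}$ all positive; that is, all of $2,4,\dots,4j-2$ occur as parts, $4j-1$ occurs exactly once, and no odd number less than $4j-1$ occurs; or (2) $\pi=(2^{f_2},4^{f_4},6^{f_6},\dots,(4j)^{f_{4j}},(4j+1)^0,(4j+2)^0,\dots)$ with $f_2,f_4,\dots,f_{4j}$ all positive; that is, all of $2,4,\dots,4j$ occur as parts, and neither $4j+2$ nor any odd number $\leq 4j+1$ occurs. $\mathcal{A}$ is the set of partitions $\pi$ such that: (i) the smallest positive integer $m$ that is not a part of $\pi$ is odd; (ii) $2m$ is also not a part of $\pi$; (iii) each even number less than $m$ appears at least twice as a part; (iv) each odd number less than $m$ appears at most twice as a part; (v) each odd part larger than $m$ is not repeated. *)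

(* Defs.v *)
From mathcomp Require Import all_boot all_order all_algebra.
From mathcomp Require Import zify.

Set Implicit Arguments.
Unset Strict Implicit.
Unset Printing Implicit Defensive.

Import GRing.Theory.

Local Open Scope nat_scope.

(* A partition is the non-increasing list of its parts. *)
Definition is_partition (s : seq nat) : bool := sorted geq s && (0 \notin s).

Fixpoint partitions_le (m n : nat) : seq (seq nat) :=
  if m is m'.+1 then
    [seq nseq k m ++ s | k <- iota 0 (n %/ m).+1,
                         s <- partitions_le m' (n - k * m)]
  else if n is 0 then [:: [::]] else [::].

(* The duplicate-free list of all partitions of n: see mem_partitions and
   uniq_partitions below. *)
Definition partitions (n : nat) : seq (seq nat) := partitions_le n n.

Lemma mem_partitions_le m n s :
  (s \in partitions_le m n) =
  [&& is_partition s, all (fun x => x <= m) s & sumn s == n].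
Proof.
have geq_trans : transitive geq by move=> y x z /= xy yz; exact: leq_trans yz xy.
elim: m n s => [|m IH] n s; last first.
  apply/idP/idP => [/allpairsPdep[k [t [kn]]]|].
    rewrite IH => /and3P[/andP[t_sorted t0] t_le /eqP st] ->.
    move: kn; rewrite mem_iota add0n ltnS leq_divRL // => kn.
    apply/and3P; split; last by rewrite sumn_cat sumn_nseq st mulnC subnKC.
      apply/andP; split; last by rewrite mem_cat negb_or mem_nseq andbF.
      elim: (k) => //= i; rewrite -/(nseq _ _) (path_sortedE geq_trans).
      move=> ->; rewrite andbT all_cat; apply/andP; split.
        by apply/allP => y; rewrite mem_nseq => /andP[_ /eqP->] /=.
      by apply: sub_all t_le => y /= /leqW.
    rewrite all_cat; apply/andP; split.
      by apply/allP => y; rewrite mem_nseq => /andP[_ /eqP->].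
    by apply: sub_all t_le => y /= /leqW.
  case/and3P => s_part s_le /eqP sn.
  have [k [t [es t_part t_le]]] : exists k t,
      [/\ s = nseq k m.+1 ++ t, is_partition t & all (leq^~ m) t].
    elim: s s_part s_le {sn} => [|x s IHs]; first by exists 0, [::].
    rewrite /is_partition /= inE negb_or (path_sortedE geq_trans).
    move=> /andP[/andP[xs ss] /andP[x0 s0]] /andP[x_le s_le].
    have [|k [t [es t_part t_le]]] := IHs _ s_le; first by rewrite /is_partition ss.
    move: x_le; rewrite leq_eqVlt ltnS => /orP[/eqP ex|x_le].
      by exists k.+1, t; rewrite es ex.
    exists 0, (x :: s); split => //.
      rewrite /is_partition /= inE negb_or x0 s0.
      by rewrite (path_sortedE geq_trans) xs ss.
    rewrite /= x_le /=; apply: sub_all xs => y /= yx; exact: leq_trans yx x_le.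
  move: sn; rewrite es sumn_cat sumn_nseq mulnC => sn.
  apply/allpairsPdep; exists k, t; split => //.
    rewrite mem_iota add0n ltnS leq_divRL // -sn; exact: leq_addr.
  by rewrite IH t_part t_le /=; apply/eqP; lia.
case: s => [|x s]; first by case: n.
have -> : is_partition (x :: s) && (all (leq^~ 0) (x :: s)
            && (sumn (x :: s) == n)) = false.
  rewrite /is_partition inE negb_or eq_sym /=.
  by case: x => [|x]; rewrite ?andbF.
by case: n.
Qed.

Lemma uniq_partitions_le m n : uniq (partitions_le m n).
Proof.
elim: m n => [|m IH] n; first by case: n.
apply: (@allpairs_uniq_dep nat (fun=> seq nat)
          _ (fun k s => nseq k m.+1 ++ s)) => [|k _|]; first exact: iota_uniq.
  exact: IH.
have ct k j t : t \in partitions_le m j -> count_mem m.+1 (nseq k m.+1 ++ t) = k.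
  rewrite mem_partitions_le => /and3P[_ t_le _].
  rewrite count_cat count_nseq /= eqxx mul1n (_ : count _ t = 0) ?addn0 //.
  apply/eqP; rewrite -leqn0 leqNgt -has_count; apply/hasPn => y /(allP t_le) /=.
  by apply: contraTneq => ->; rewrite ltnn.
move=> _ _ /allpairsPdep[k [t [_ tm ->]]] /allpairsPdep[k' [t' [_ tm' ->]]] /= e.
have ek : k = k' by rewrite -(ct k _ _ tm) e (ct k' _ _ tm').
move: e {tm tm'}; rewrite -ek => /(congr1 (drop k)).
by rewrite !drop_size_cat ?size_nseq // => ->.
Qed.

Lemma mem_partitions n s :
  (s \in partitions n) = is_partition s && (sumn s == n).
Proof.
rewrite mem_partitions_le andbA [in LHS]andbAC; apply: andb_idr.
move=> /andP[_ /eqP <-]; apply/allP; elim: s => //= x s IH y.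
rewrite inE => /orP[/eqP->|/IH ys]; first exact: leq_addr.
exact: leq_trans ys (leq_addl _ _).
Qed.

Lemma uniq_partitions n : uniq (partitions n).
Proof. exact: uniq_partitions_le. Qed.

(* A formal power series in q is given by its sequence of coefficients, and
   gen_fun P w is the series \sum_{pi in P} w(pi) q^|pi|. *)
Definition gen_fun (P : pred (seq nat)) (w : seq nat -> rat) : nat -> rat :=
  fun n => (\sum_(s <- partitions n | P s) w s)%R.

(* The predicates below are meant for lists s such that is_partition s. *)

Definition GG2 (s : seq nat) : bool :=
  [&& all (fun x => 3 <= x) s,
      sorted (fun x y => y + 2 <= x) s &
      all (fun x => ~~ odd x ==> (x + 2 \notin s)) s].

(* nth 0 s i is lambda_(i+1), hence 0 when i = size s. *)
Definition omega2 (s : seq nat) : rat :=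
  (\prod_(i < size s)
     (((nth 0%N s i)%:R - (nth 0%N s i.+1)%:R
       - (~~ odd (nth 0%N s i))%:R - (~~ odd (nth 0%N s i.+1))%:R) / 2))%R.

Definition smallest_part (s : seq nat) : nat := last 0 s.

Definition rdo_start1 (s : seq nat) (j : nat) : bool :=
  [&& all (fun i => 2 * i \in s) (iota 1 (2 * j - 1)),
      count_mem (4 * j - 1) s == 1 &
      all (fun x => odd x ==> (4 * j - 1 <= x)) s].

Definition rdo_start2 (s : seq nat) (j : nat) : bool :=
  [&& all (fun i => 2 * i \in s) (iota 1 (2 * j)),
      4 * j + 2 \notin s &
      all (fun x => odd x ==> (4 * j + 1 < x)) s].

(* The search for j is bounded only for decidability: see rdo_startP. *)
Definition rdo_start (s : seq nat) : bool :=
  has (fun j => rdo_start1 s j || rdo_start2 s j) (iota 1 (size s)).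

Lemma rdo_startP s :
  reflect (exists2 j, 0 < j & rdo_start1 s j \/ rdo_start2 s j) (rdo_start s).
Proof.
apply: (iffP hasP) => [[j]|[j j0 js]].
  by rewrite mem_iota => /andP[j0 _] /orP; exists j.
exists j; last exact/orP.
have sub k : all (fun i => 2 * i \in s) (iota 1 k) -> k <= size s.
  move=> /allP ks; rewrite -(size_iota 1 k) -(size_map (muln 2)).
  apply: uniq_leq_size => [|_ /mapP[i /ks is_s ->] //].
  by rewrite map_inj_uniq ?iota_uniq // => x y /eqP; rewrite eqn_pmul2l // => /eqP.
rewrite mem_iota j0 add1n ltnS.
by case: js => /and3P[/sub + _ _]; lia.
Qed.

Definition Prdo (s : seq nat) : bool :=
  [&& all (fun x => odd x ==> (count_mem x s <= 1)) s,
      (s != [::]) ==> (1 < smallest_part s) &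
      (smallest_part s == 2) ==> rdo_start s].

Lemma mex_exists (s : seq nat) : exists m, (0 < m) && (m \notin s).
Proof.
exists (sumn s).+1; rewrite ltn0Sn; apply/negP.
elim: s => //= x s; set n := sumn s => IH.
suff H t y : y \in t -> y <= sumn t.
  by rewrite -[x + n]/(sumn (x :: s)) => /H; rewrite ltnn.
elim: t => //= z t IHt; rewrite inE => /orP[/eqP->|/IHt]; lia.
Qed.

Definition mex (s : seq nat) : nat := ex_minn (mex_exists s).

Definition Aset (s : seq nat) : bool :=
  let m := mex s in
  [&& odd m,
      2 * m \notin s,
      all (fun i => ~~ odd i ==> (2 <= count_mem i s)) (iota 1 m.-1),
      all (fun i => odd i ==> (count_mem i s <= 2)) (iota 1 m.-1) &
      all (fun x => odd x && (m < x) ==> (count_mem x s <= 1)) s].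

(* Main.v *)
(* Write D = prod_{i >= 1} 1/(1 - q^(2i)) and V_k = prod_{i >= k} (1 + q^(2i+1)).

   Recording a partition of GG2 by the parities of its parts and the factors of
   omega2 turns the weighted sum into
     L_0 = sum_n q^(n^2+2n) (-q;q^2)_n / (q^2;q^2)_n^2.
   With L_k = sum_n q^(n^2+2n+2kn) (-q;q^2)_n / ((q^2;q^2)_n (q^2;q^2)_(n+k)),
   contiguous relations give L_k = V_(k+1) D - q^(2k+2) L_(k+1), hence
     L_0 = sum_j (-1)^j q^(j(j+1)) V_(j+1) D.
   The j-th summand without its sign counts the partitions with distinct odd
   parts, all >= 2j+3, that contain 2, 4, ..., 2j.  A given partition satisfies
   this for an initial segment of values j, so the alternating sum counts the
   partitions for which that segment has odd length: these are those of Prdo.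
   Finally the partitions of Aset with mex 2l+1 have generating function
     q^(3l^2+2l) (1 - q^(2l+1)) V_0 D,
   and the sum over l equals the previous one by a false theta identity of
   Rogers.

   To compare coefficients of q^n, all series are evaluated at the class of 'X
   in {poly %/ 'X^N} with N > n: q is nilpotent, so that products and sums are
   finite and 1 - q^i has an explicit inverse. *)
Require Import Defs.
From mathcomp Require Import all_boot all_order all_algebra.
From mathcomp Require Import qpoly zify ring.

Set Implicit Arguments.
Unset Strict Implicit.
Unset Printing Implicit Defensive.

Import GRing.Theory.

Local Open Scope ring_scope.

(** * Identities between series in a nilpotent variable *)

Section NilpotentSeries.

Variables (K : comNzRingType) (q : K) (N : nat).
Hypothesis qN : q ^+ N = 0.

Lemma expr_nilpotent m : (N <= m)%N -> q ^+ m = 0.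
Proof. by move=> Nm; rewrite -(subnK Nm) exprD qN mulr0. Qed.

Definition geo (i : nat) : K := \sum_(j < N) q ^+ (i * j).

Lemma geoP i : (0 < i)%N -> (1 - q ^+ i) * geo i = 1.
Proof.
move=> i0; rewrite /geo.
under eq_bigr do rewrite exprM.
rewrite -[1 - _]opprB mulNr -subrX1 -exprM expr_nilpotent ?leq_pmull //.
by rewrite sub0r opprK.
Qed.

Lemma geo_unique i x y : (0 < i)%N -> x * (1 - q ^+ i) = y -> x = y * geo i.
Proof. by move=> i0 <-; rewrite -mulrA geoP ?mulr1. Qed.

(* (-q;q^2)_n, its cofactor in (-q;q^2)_oo (as q^(2i+1) = 0 for i >= N), and
   1/(q^2;q^2)_n. *)
Definition oddP (n : nat) : K := \prod_(i < n) (1 + q ^+ (2 * i + 1)).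
Definition oddT (k : nat) : K := \prod_(k <= i < N) (1 + q ^+ (2 * i + 1)).
Definition invE (n : nat) : K := \prod_(i < n) geo (2 * i + 2).

Lemma oddPS n : oddP n.+1 = oddP n * (1 + q ^+ (2 * n + 1)).
Proof. exact: big_ord_recr. Qed.

Lemma oddT_rec k : oddT k = (1 + q ^+ (2 * k + 1)) * oddT k.+1.
Proof.
case: (ltnP k N) => [kN|Nk]; first by rewrite /oddT big_ltn.
rewrite /oddT !big_geq ?expr_nilpotent ?addr0 ?mulr1 //; lia.
Qed.

Lemma invE_rec n : invE n = (1 - q ^+ (2 * n + 2)) * invE n.+1.
Proof.
have := geoP (i := 2 * n + 2) ltac:(lia).
by rewrite /invE big_ord_recr /= mulrCA => ->; rewrite mulr1.
Qed.

(** The factor [1 - q ^+ (2 * n)] kills the term [n = 0] and lowers the index of [invE] by one in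
    the others, so the sum can be reindexed. The free [h] covers both [invE (n + k)] and
    [invE (n + k.+1)]. *)
Lemma sum_shift k (h : nat -> K) :
  \sum_(n < N) q ^+ (n * n + 2 * k * n) * (oddP n * invE n * h n)
      * (1 - q ^+ (2 * n)) =
  q ^+ (2 * k + 1) * \sum_(n < N) q ^+ (n * n + 2 * k.+1 * n)
      * (oddP n * invE n * h n.+1) * (1 + q * q ^+ (2 * n)).
Proof.
have [m Nm] : exists m, N = m.+1.
  case: N qN => [/eqP|m _]; last by exists m.
  by rewrite expr0 oner_eq0.
(* After reindexing, only the top term [n = m] of the right-hand side has no partner; its exponent
   is at least [N]. *)
have last0 x y : q ^+ (2 * k + 1) * (q ^+ (m * m + 2 * k.+1 * m) * x * y) = 0.
  by rewrite !mulrA -exprD expr_nilpotent ?mul0r //; nia.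
move: (oddPS) (invE_rec) last0; move: oddP invE.
rewrite Nm => oP iE oS iS last0.
rewrite big_ord_recl big_ord_recr /= [RHS]mulrDr last0 [q ^+ (2 * 0)]expr0 subrr.
rewrite !mulr0 add0r addr0 mulr_sumr; apply: eq_bigr => i _.
rewrite /bump leq0n add1n oS (iS i).
have -> : (i.+1 * i.+1 + 2 * k * i.+1 = (2 * k + 1) + (i * i + 2 * k.+1 * i))%N by nia.
have -> : (2 * i.+1 = 2 * i + 2)%N by lia.
by rewrite [in LHS](exprD _ (2 * k + 1)) !addn1 !(exprS q (2 * _)); ring.
Qed.

Definition gg_term (k n : nat) : K :=
  q ^+ (n * n + 2 * k * n) * (oddP n * invE n * invE (n + k)).

(** [ggL k] is the truncated L_k. Its companion [ggM k], without the factor [q ^+ (2 * n)], has the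
    product form V_k D and is used to solve for [ggL]. *)
Definition ggM k : K := \sum_(n < N) gg_term k n.
Definition ggL k : K := \sum_(n < N) gg_term k n * q ^+ (2 * n).

(** A hybrid with the exponent of [ggM k] and the denominator of [ggM k.+1]; two relations with
    [ggM] allow it to be eliminated. *)
Let ggC k : K :=
  \sum_(n < N) q ^+ (n * n + 2 * k * n) * (oddP n * invE n * invE (n + k.+1)).

Lemma ggM_ggL k : ggM k - ggL k = q ^+ (2 * k + 1) * (ggM k.+1 + q * ggL k.+1).
Proof.
transitivity (\sum_(n < N) q ^+ (n * n + 2 * k * n) *
    (oddP n * invE n * invE (n + k)) * (1 - q ^+ (2 * n))).
  by rewrite /ggM /ggL -sumrB; apply: eq_bigr => n _; rewrite mulrBr mulr1.
rewrite (sum_shift k (fun n => invE (n + k))) mulr_sumr /ggM /ggL.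
rewrite [q * _]mulr_sumr -big_split mulr_sumr; apply: eq_bigr => n _.
rewrite /gg_term addSnnS /=; ring.
Qed.

(** Insert 1 = (1 - q^(2(n+k)+2)) + q^(2k+2) q^(2n) in each term. *)
Let ggC_ggM k : ggC k = ggM k + q ^+ (2 * k + 2) * ggM k.+1.
Proof.
rewrite /ggC /ggM mulr_sumr -big_split; apply: eq_bigr => n _ /=.
rewrite /gg_term (invE_rec (n + k)) addnS.
have -> : (2 * (n + k) + 2 = 2 * k + 2 + 2 * n)%N by lia.
have -> : (n * n + 2 * k.+1 * n = 2 * n + (n * n + 2 * k * n))%N by nia.
by rewrite (exprD _ (2 * k + 2)) (exprD _ (2 * n)); ring.
Qed.

Let ggC_shift k :
  ggC k - ggM k.+1 = q ^+ (2 * k + 1) * (ggC k.+1 + q * ggM k.+2).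
Proof.
transitivity (\sum_(n < N) q ^+ (n * n + 2 * k * n) *
    (oddP n * invE n * invE (n + k.+1)) * (1 - q ^+ (2 * n))).
  rewrite /ggC /ggM -sumrB; apply: eq_bigr => n _.
  have -> : gg_term k.+1 n = q ^+ (n * n + 2 * k * n + 2 * n) *
    (oddP n * invE n * invE (n + k.+1)).
    by rewrite /gg_term; congr (q ^+ _ * _); nia.
  by rewrite (exprD _ _ (2 * n)); ring.
rewrite (sum_shift k (fun n => invE (n + k.+1))) mulr_sumr /ggM /ggC.
rewrite [q * _]mulr_sumr -big_split mulr_sumr; apply: eq_bigr => n _ /=.
have -> : gg_term k.+2 n = q ^+ (n * n + 2 * k.+1 * n + 2 * n) *
    (oddP n * invE n * invE (n + k.+2)).
  by rewrite /gg_term; congr (q ^+ _ * _); nia.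
by rewrite (exprD _ _ (2 * n)) (_ : (n.+1 + k.+1 = n + k.+2)%N); [ring | lia].
Qed.

(** Iterating the relation [N] times brings out the factor [q ^+ N]. *)
Lemma nilpotent_rec_eq0 (d : nat -> K) :
  (forall k, exists c, d k = q * c * d k.+1) -> forall k, d k = 0.
Proof.
move=> drec k; have H j : exists c, d k = q ^+ j * c * d (k + j)%N.
  elim: j => [|j [c IH]]; first by exists 1; rewrite addn0 expr0 !mul1r.
  have [c' dj] := drec (k + j)%N.
  by exists (c * c'); rewrite IH dj exprS addnS; ring.
by have [c ->] := H N; rewrite qN !mul0r.
Qed.

Lemma ggM_rec k : ggM k = (1 + q ^+ (2 * k + 1)) * ggM k.+1.
Proof.
apply/eqP; rewrite -subr_eq0; apply/eqP.
(* Eliminating [ggC] shows that this defect satisfies [d k = - q ^+ (2 * k + 1) * q * d k.+1]. *)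
pose d k := ggM k - (1 + q ^+ (2 * k + 1)) * ggM k.+1.
apply: (nilpotent_rec_eq0 (d := d)) => {}k; exists (- q ^+ (2 * k + 1)).
have := ggC_shift k; rewrite !ggC_ggM /d.
have -> : q ^+ (2 * k + 2) = q ^+ (2 * k + 1) * q by rewrite -exprSr addnS addn1.
have -> : q ^+ (2 * k.+1 + 2) = q ^+ (2 * k + 1) * q ^+ 3.
  by rewrite -exprD; congr (q ^+ _); lia.
have -> : q ^+ (2 * k.+1 + 1) = q ^+ (2 * k + 1) * q ^+ 2.
  by rewrite -exprD; congr (q ^+ _); lia.
set x := q ^+ _ => /(canRL (subrK _)) e.
have -> : ggM k = (ggM k + x * q * ggM k.+1) - x * q * ggM k.+1 by ring.
by rewrite e; ring.
Qed.

(** At level [N] every term with [n > 0] has exponent at least [N]. This starts the descending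
    induction of [ggME]. *)
Lemma ggM_N : ggM N = invE N.
Proof.
have N0 : (0 < N)%N.
  by rewrite lt0n; apply: contra_eq_neq qN => ->; rewrite expr0 oner_neq0.
rewrite /ggM (bigD1 (Ordinal N0)) //= big1 => [|i i0].
  by rewrite /gg_term !muln0 addr0 expr0 mul1r /oddP {1}/invE !big_ord0 !mul1r.
have {}i0 : (0 < i)%N by rewrite lt0n.
by rewrite /gg_term expr_nilpotent ?mul0r //; nia.
Qed.

Lemma ggME k : (k <= N)%N -> ggM k = oddT k * invE N.
Proof.
move=> kN; rewrite -(subKn kN); elim: (N - k)%N (leq_subr k N) => [|j IH] jN.
  by rewrite subn0 ggM_N /oddT big_geq // mul1r.
have e : (N - j = (N - j.+1).+1)%N by lia.
by rewrite ggM_rec oddT_rec -e IH; [rewrite mulrA | lia].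
Qed.

(** The product form of [ggM] at levels [k] and [k.+1] eliminates it from [ggM_ggL]. *)
Lemma ggL_rec k : (k < N)%N ->
  ggL k = oddT k.+1 * invE N - q ^+ (2 * k + 2) * ggL k.+1.
Proof.
move=> kN; have /(canRL (subrK _)) := ggM_ggL k.
have -> : q ^+ (2 * k + 2) = q ^+ (2 * k + 1) * q by rewrite -exprSr addnS addn1.
rewrite (ggME (ltnW kN)) (ggME kN) (oddT_rec k).
set x := q ^+ _ => e.
have -> : ggL k = (1 + x) * oddT k.+1 * invE N - (x * (oddT k.+1 * invE N + q * ggL k.+1)).
  by rewrite e; ring.
by ring.
Qed.

Lemma ggL_sum : ggL 0 =
  \sum_(n < N) (-1) ^+ n * q ^+ (n * n.+1) * oddT n.+1 * invE N.
Proof.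
(* Unfold the recurrence [m] times; at [m = N] the remainder contains [q ^+ (N * N.+1) = 0]. *)
suff H m : (m <= N)%N -> ggL 0 =
    \sum_(n < m) (-1) ^+ n * q ^+ (n * n.+1) * oddT n.+1 * invE N
    + (-1) ^+ m * q ^+ (m * m.+1) * ggL m.
  by rewrite (H N) // (@expr_nilpotent (N * N.+1)) ?mulr0 ?mul0r ?addr0 //; nia.
elim: m => [|m IH] mN; first by rewrite big_ord0 mul0n !expr0 add0r !mul1r.
rewrite (IH (ltnW mN)) big_ord_recr /= ggL_rec //.
have -> : (m.+1 * m.+2 = m * m.+1 + (2 * m + 2))%N by nia.
rewrite (exprD _ (m * m.+1)) exprS; ring.
Qed.

(* Rogers' false theta identity
   sum_n (-1)^n q^(n(n+1)) / (-q;q^2)_(n+1) = sum_k q^(3k^2+2k) (1 - q^(2k+1)),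
   multiplied by (-q;q^2)_oo: this is the Rogers-Fine iteration, which for the
   parameters at hand shifts k by one. *)
Let rf_term (k n : nat) : K :=
  (-1) ^+ n * q ^+ (n * n + (4 * k + 1) * n) * oddT (k + n).+1.

Definition rfS k : K := \sum_(n < N) rf_term k n.

Lemma rfS_rec k : rfS k =
  (1 - q ^+ (2 * k + 1)) * oddT k +
  q ^+ (6 * k + 5) * (1 + q ^+ (2 * k + 1)) * rfS k.+1.
Proof.
(* Telescoping certificate: the facts below give [rf_term k n.+1 = (1 + x) * (q ^+ (6 * k + 5) *
   rf_term k.+1 n) + w n.+1 - w n.+2]. *)
pose w n := (-1) ^+ n * q ^+ (n * n + (4 * k + 1) * n) * oddT (k + n).
pose x := q ^+ (2 * k + 1).
have wE n : w n = (1 + x * q ^+ (2 * n)) * rf_term k n.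
  rewrite /w /rf_term (oddT_rec (k + n)) /x -exprD.
  have -> : (2 * (k + n) + 1 = 2 * k + 1 + 2 * n)%N by lia.
  by rewrite mulrCA !mulrA.
have wS n : w n.+1 = - (q ^+ (2 * n) * x ^+ 2) * rf_term k n.
  rewrite /w /rf_term (addnS k) /x -exprM -exprD exprS.
  have -> : (n.+1 * n.+1 + (4 * k + 1) * n.+1 =
    2 * n + (2 * k + 1) * 2 + (n * n + (4 * k + 1) * n))%N by nia.
  by rewrite (exprD _ (2 * n + _)); ring.
have vE n : q ^+ (6 * k + 5) * rf_term k.+1 n =
    - (x * q ^+ (2 * n.+1) * rf_term k n.+1).
  rewrite /rf_term /x (addSnnS k) (exprS (-1)).
  transitivity ((-1) ^+ n * oddT (k + n.+1).+1 *
      q ^+ (6 * k + 5 + (n * n + (4 * k.+1 + 1) * n))).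
    by rewrite (exprD _ (6 * k + 5)); ring.
  have -> : (6 * k + 5 + (n * n + (4 * k.+1 + 1) * n) =
      2 * k + 1 + 2 * n.+1 + (n.+1 * n.+1 + (4 * k + 1) * n.+1))%N by nia.
  by rewrite (exprD _ (_ + 2 * n.+1)) (exprD _ (2 * k + 1)); ring.
have rf0 m : (N <= m)%N -> rf_term k m = 0.
  by move=> Nm; rewrite /rf_term expr_nilpotent ?mulr0 ?mul0r //; nia.
have H m : \sum_(n < m.+1) rf_term k n =
  (1 - x) * oddT k + (1 + x) * \sum_(n < m) (q ^+ (6 * k + 5) * rf_term k.+1 n)
  - w m.+1.
  elim: m => [|m IH].
    rewrite big_ord_recr !big_ord0 mulr0 addr0 wS muln0 /rf_term.
    rewrite (oddT_rec k) -/x !muln0 expr0 addn0 expr0 /= add0r; ring.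
  rewrite big_ord_recr IH [in RHS]big_ord_recr /= vE wE wS; ring.
have : \sum_(n < N.+1) rf_term k n = rfS k.
  by rewrite big_ord_recr /= rf0 ?addr0.
rewrite H -mulr_sumr wS rf0 // mulr0 subr0 => <-; rewrite /rfS -/x; ring.
Qed.

Lemma rfS_sum : rfS 0 =
  \sum_(k < N) q ^+ (3 * (k * k) + 2 * k) * oddP k * (1 - q ^+ (2 * k + 1)) * oddT k.
Proof.
(* Over [m] iterations the exponents [6 * i + 5] add up to [3 * (m * m) + 2 * m], and the factors
   [1 + q ^+ (2 * i + 1)] build [oddP q m]. *)
suff H m : rfS 0 =
  \sum_(k < m) q ^+ (3 * (k * k) + 2 * k) * oddP k * (1 - q ^+ (2 * k + 1)) * oddT k
  + q ^+ (3 * (m * m) + 2 * m) * oddP m * rfS m.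
  by rewrite (H N) (@expr_nilpotent (3 * (N * N) + _)) ?mul0r ?addr0 //; nia.
elim: m => [|m ->]; first by rewrite big_ord0 /oddP big_ord0 expr0 add0r !mul1r.
rewrite big_ord_recr /= -addrA; congr (_ + _); rewrite rfS_rec oddPS.
have -> : (3 * (m.+1 * m.+1) + 2 * m.+1 = 3 * (m * m) + 2 * m + (6 * m + 5))%N by nia.
rewrite (exprD _ _ (6 * m + 5)); ring.
Qed.

Lemma rogers_false_theta :
  \sum_(n < N) (-1) ^+ n * q ^+ (n * n.+1) * oddT n.+1 * invE N =
  \sum_(k < N) q ^+ (3 * (k * k) + 2 * k) * oddP k
     * (1 - q ^+ (4 * k + 2)) * oddT k.+1 * invE N.
Proof.
rewrite -!mulr_suml; congr (_ * _).
transitivity (rfS 0).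
  apply: eq_bigr => n _; rewrite /rf_term add0n.
  by congr (_ * q ^+ _ * _); nia.
(* The first factor of [oddT k] completes [1 - q ^+ (2 * k + 1)] to [1 - q ^+ (4 * k + 2)], the
   factor that forbids twice the mex in [Aset]. *)
rewrite rfS_sum; apply: eq_bigr => k _; rewrite (oddT_rec k).
have -> : (4 * k + 2 = (2 * k + 1) * 2)%N by lia.
rewrite (exprM _ _ 2); ring.
Qed.

End NilpotentSeries.

(** * Partitions with restricted multiplicities *)

Lemma in_qpoly_Xn_eq (R : comNzRingType) N (p r : {poly R}) n : (n < N)%N ->
  in_qpoly 'X^N p = in_qpoly 'X^N r -> p`_n = r`_n.
Proof.
move=> nN /(congr1 val) /=; rewrite mk_monic_Xn (ltn_predK nN).
by rewrite -!Pdiv.RingMonic.take_poly_rmodp => /(congr1 (coefp n)) /=; rewrite !coef_take_poly nN.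
Qed.

Lemma in_qpoly_Xn_nilpotent (R : comNzRingType) N :
  (0 < N)%N -> in_qpoly 'X^N ('X : {poly R}) ^+ N = 0.
Proof.
move=> N0; rewrite -rmorphXn; apply: val_inj => /=.
by rewrite mk_monic_Xn prednK // Pdiv.RingMonic.rmodpp ?monicXn.
Qed.

Definition admissible (c : nat -> nat -> bool) (m : nat) (s : seq nat) : bool :=
  all (fun i => c i (count_mem i s)) (iota 1 m).

(** The bound [L] on multiplicities keeps the factors finite and does not affect coefficients of
    index below [L]. *)
Definition mult_gf (K : comNzRingType) (c : nat -> nat -> bool) L m (q : K) : K :=
  \prod_(i < m) \sum_(k < L | c i.+1 k) q ^+ (i.+1 * k).

(** Coefficients are read in [{poly rat}] while closed forms hold in the quotient; this passes from
    one to the other. *)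
Lemma rmorph_mult_gf (K K' : comNzRingType) (f : {rmorphism K -> K'}) c L m q :
  f (mult_gf c L m q) = mult_gf c L m (f q).
Proof.
rewrite rmorph_prod; apply: eq_bigr => i _.
by rewrite rmorph_sum; apply: eq_bigr => k _; rewrite rmorphXn.
Qed.

(** Choosing the multiplicity [k] of the largest allowed part, as [partitions_le] does, peels off
    the last factor of the product. *)
Lemma coef_mult_gf c L m n : (n < L)%N ->
  \sum_(s <- partitions_le m n | admissible c m s) 1 =
  (mult_gf c L m ('X : {poly rat}))`_n.
Proof.
elim: m n => [|m IH] n nL.
  rewrite /mult_gf big_ord0 coef1; case: n {nL} => [|n] /=.
    by rewrite big_cons big_nil addr0.
  by rewrite big_nil.
rewrite big_mkcond [partitions_le _ _]/(allpairs_dep _ _ _) big_allpairs_dep.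
rewrite /mult_gf big_ord_recr -/(mult_gf c L m 'X) [X in X`_n]/= mulr_sumr coef_sum.
rewrite -(big_mkord (c m.+1) (fun k => (mult_gf c L m 'X * 'X^(m.+1 * k))`_n)).
have nm : ((n %/ m.+1).+1 <= L)%N by apply: leq_ltn_trans nL; exact: leq_div.
rewrite (big_cat_nat (leq0n _) nm) [RHS]/= [X in _ + X]big_nat_cond.
(* More than [n %/ m.+1] copies of [m.+1] exceed [n], so these terms contribute nothing to the
   coefficient. *)
rewrite [X in _ + X]big1 ?addr0 => [|k /andP[/andP[nk _] _]]; last first.
  by rewrite coefMXn ifT //; move: nk; rewrite ltn_divLR // mulnC.
rewrite [RHS]big_mkcond /index_iota subn0.
apply: eq_big_seq => k; rewrite mem_iota add0n ltnS => /andP[_ kn].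
have {}kn : (m.+1 * k <= n)%N by move: kn; rewrite leq_divRL // mulnC.
have adm s : s \in partitions_le m (n - k * m.+1) ->
    admissible c m.+1 (nseq k m.+1 ++ s) = c m.+1 k && admissible c m s.
  rewrite mem_partitions_le => /and3P[_ /allP s_le _].
  rewrite /admissible -addn1 iotaD all_cat /= andbT add1n addn1 andbC.
  congr (c _ _ && _).
    rewrite count_cat count_nseq /= eqxx mul1n (_ : count _ s = 0) ?addn0 //.
    by apply/count_memPn/negP => /s_le; rewrite ltnn.
  apply: eq_in_all => i; rewrite mem_iota => i_le; congr (c _ _).
  by rewrite count_cat count_nseq /= (_ : (_ == _) = false) //; lia.
transitivity (\sum_(s <- partitions_le m (n - k * m.+1))
    if c m.+1 k && admissible c m s then 1 else 0 : rat).
  by apply: eq_big_seq => s /adm ->.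
rewrite -big_mkcond; case: ifP => /= ck; last by rewrite big_pred0.
rewrite IH ?coefMXn ?ifF -?[(_ * k)%N]mulnC //; lia.
Qed.

(** This permits the common bound [2 * N], which is even so that the parts group into pairs
    [2 * t + 1], [2 * t + 2]. *)
Lemma perm_partitions_le m n : (n <= m)%N ->
  perm_eq (partitions n) (partitions_le m n).
Proof.
move=> nm; apply: uniq_perm => [||s]; rewrite ?uniq_partitions ?uniq_partitions_le //.
apply/idP/idP => [sn|]; last first.
  by rewrite mem_partitions mem_partitions_le => /and3P[-> _ ->].
have := sn; rewrite mem_partitions mem_partitions_le => /andP[-> ->].
move: sn; rewrite andbT mem_partitions_le => /and3P[_ + _].
by apply: sub_all => x /leq_trans; apply.
Qed.

(** * Closed forms of the factors for each multiplicity condition *)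

Section Factors.

Variables (K : comNzRingType) (q : K) (N : nat).
Hypothesis qN : q ^+ N = 0.

Lemma factor_ge a i L : (0 < i)%N -> (a <= L)%N -> (N <= L)%N ->
  \sum_(k < L | (a <= k)%N) q ^+ (i * k) = q ^+ (i * a) * geo q N i.
Proof.
move=> i0 aL NL; rewrite -(big_geq_mkord _ _ xpredT (fun k => q ^+ (i * k))); apply: (geo_unique qN) => //.
rewrite mulr_suml.
transitivity (- \sum_(a <= k < L) (q ^+ (i * k.+1) - q ^+ (i * k))).
  by rewrite -sumrN; apply: eq_bigr => k _; rewrite mulrBr mulr1 -exprD opprB mulnS addnC.
rewrite (telescope_sumr (fun k => q ^+ (i * k))) //.
by rewrite (expr_nilpotent qN (_ : N <= i * L)%N) ?sub0r ?opprK //; nia.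
Qed.

Lemma factor_le1 i L : \sum_(k < L.+2 | (k <= 1)%N) q ^+ (i * k) = 1 + q ^+ i.
Proof.
rewrite big_mkcond !big_ord_recl big1 //= muln0 expr0 muln1 addr0.
by [].
Qed.

Lemma factor_le0 i L : \sum_(k < L.+1 | (k <= 0)%N) q ^+ (i * k) = 1.
Proof. by rewrite big_mkcond big_ord_recl big1 //= muln0 expr0 addr0. Qed.

Lemma factor_12 i L :
  \sum_(k < L.+3 | (0 < k <= 2)%N) q ^+ (i * k) = q ^+ i * (1 + q ^+ i).
Proof.
rewrite big_mkcond !big_ord_recl big1 //= muln1 add0r addr0.
by rewrite mulrDr mulr1 -exprD muln2 addnn.
Qed.

Lemma prod_pairs (F : nat -> K) m :
  \prod_(i < 2 * m) F i = \prod_(t < m) (F (2 * t)%N * F (2 * t).+1).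
Proof.
elim: m => [|m IH]; first by rewrite muln0 !big_ord0.
by rewrite mulnS add2n !big_ord_recr /= IH mulrA.
Qed.

Lemma prod_gt (F : nat -> K) m j :
  \prod_(t < m) (if (j < t)%N then F t else 1) = \prod_(j.+1 <= t < m) F t.
Proof. by rewrite -big_mkcond big_geq_mkord. Qed.

Lemma prod_lt (F : nat -> K) m j : (j <= m)%N ->
  \prod_(t < m) (if (t < j)%N then F t else 1) = \prod_(t < j) F t.
Proof. by move=> jm; rewrite -big_mkcond (big_ord_widen m F). Qed.

End Factors.

(* The bounds [k <= b] and [b <= k] with b : bool coerced to nat read
   "k <= 1 if b, else k = 0" and "k > 0 if b". *)
Definition condT (j i k : nat) : bool :=
  if odd i then (k <= (2 * j + 3 <= i))%N else ((i <= 2 * j) <= k)%N.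

(** Membership in [Aset] with mex [2 * l + 1]. At [i = 2 * l + 1] the bound reads [k <= false], so
    the mex is absent; [4 * l + 2] is its double. *)
Definition condA (l i k : nat) : bool :=
  if odd i then if (i < 2 * l + 1)%N then (0 < k <= 2)%N
                else (k <= (2 * l + 1 < i))%N
  else if (i < 2 * l + 1)%N then (2 <= k)%N else (i == 4 * l + 2) ==> (k == 0).

Lemma mult_gf_condT (K : comNzRingType) (q : K) N j :
  q ^+ N = 0 -> (j <= N)%N ->
  mult_gf (condT j) N.+3 (2 * N) q =
  q ^+ (j * j.+1) * oddT q N j.+1 * invE q N N.
Proof.
move=> qN jN; rewrite /mult_gf.
rewrite (prod_pairs (fun i => \sum_(k < N.+3 | condT j i.+1 k) q ^+ (i.+1 * k))).
transitivity (\prod_(t < N) ((if (t < j)%N then q ^+ (2 * t + 2) else 1) *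
   (if (j < t)%N then 1 + q ^+ (2 * t + 1) else 1) * geo q N (2 * t + 2))).
  apply: eq_bigr => t _.
  rewrite mulrAC [RHS]mulrC; congr (_ * _).
    rewrite /condT oddS oddM /= (_ : (2 * j + 3 <= (2 * t).+1)%N = (j < t)%N); last lia.
    case: (j < t)%N => /=; first by rewrite factor_le1 addn1.
    exact: factor_le0.
  rewrite /condT !oddS oddM /= (_ : ((2 * t).+2 <= 2 * j)%N = (t < j)%N); last lia.
  rewrite addn2 (factor_ge qN) //; try lia.
  by case: (t < j)%N; rewrite ?muln1 ?muln0.
rewrite !big_split /= (prod_lt (fun t => q ^+ (2 * t + 2))) // (prod_gt (fun t => 1 + q ^+ (2 * t + 1))) /oddT /invE.
congr (_ * _ * _); elim: {jN}j => [|j IH]; first by rewrite big_ord0 expr0.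
by rewrite big_ord_recr /= IH -exprD; congr (q ^+ _); nia.
Qed.

Lemma mult_gf_condA (K : comNzRingType) (q : K) N l :
  q ^+ N = 0 -> (l < N)%N ->
  mult_gf (condA l) N.+3 (2 * N) q =
  q ^+ (3 * (l * l) + 2 * l) * oddP q l * (1 - q ^+ (4 * l + 2))
   * oddT q N l.+1 * invE q N N.
Proof.
move=> qN lN; rewrite /mult_gf.
rewrite (prod_pairs (fun i => \sum_(k < N.+3 | condA l i.+1 k) q ^+ (i.+1 * k))).
(* For [t < l], one forced copy of [2 * t + 1] and two of [2 * t + 2] give the exponent [6 * t + 5].
   At [t = 2 * l] the factor [1 - q ^+ (2 * t + 2)] cancels the geometric series of the forbidden
   part. *)
transitivity (\prod_(t < N) (
   (if (t < l)%N then q ^+ (6 * t + 5) * (1 + q ^+ (2 * t + 1)) else 1) *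
   (if t == 2 * l :> nat then 1 - q ^+ (2 * t + 2) else 1) *
   (if (l < t)%N then 1 + q ^+ (2 * t + 1) else 1) * geo q N (2 * t + 2))).
  apply: eq_bigr => t _.
  have -> : \sum_(k < N.+3 | condA l (2 * t).+1 k) q ^+ ((2 * t).+1 * k) =
     (if (t < l)%N then q ^+ (2 * t + 1) * (1 + q ^+ (2 * t + 1)) else 1) *
     (if (l < t)%N then 1 + q ^+ (2 * t + 1) else 1).
    rewrite /condA oddS oddM /= !addn1.
    rewrite (_ : ((2 * t).+1 < (2 * l).+1)%N = (t < l)%N); last lia.
    rewrite (_ : ((2 * l).+1 < (2 * t).+1)%N = (l < t)%N); last lia.
    case: ltngtP => tl /=; rewrite ?mulr1 ?mul1r;
      by [exact: factor_12 | exact: factor_le1 | exact: factor_le0].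
  have -> : \sum_(k < N.+3 | condA l (2 * t).+2 k) q ^+ ((2 * t).+2 * k) =
     (if (t < l)%N then q ^+ (4 * t + 4) else 1) *
     (if t == 2 * l :> nat then 1 - q ^+ (2 * t + 2) else 1) * geo q N (2 * t + 2).
    rewrite /condA !oddS oddM /= addn2.
    rewrite (_ : ((2 * t).+2 < 2 * l + 1)%N = (t < l)%N); last lia.
    rewrite (_ : ((2 * t).+2 == 4 * l + 2) = (t == 2 * l :> nat)); last lia.
    case: ltnP => tl /=.
      rewrite (factor_ge qN) ?ifF ?mulr1; try lia.
      by congr (q ^+ _ * _); lia.
    rewrite mul1r; case: eqP => /= _.
      by rewrite (geoP qN) // -(factor_le0 q (2 * t).+2 N.+2); apply: eq_bigl => k; rewrite leqn0.
    have := factor_ge qN (a := 0) (i := (2 * t).+2) (L := N.+3) isT isT.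
    by rewrite muln0 expr0 !mul1r => <- //; lia.
  case: ifP => _; last by ring.
  have -> : (6 * t + 5 = 2 * t + 1 + (4 * t + 4))%N by lia.
  by rewrite [in RHS]exprD; ring.
rewrite !big_split /= (prod_gt (fun t => 1 + q ^+ (2 * t + 1))) -/(oddT q N l.+1) -/(invE q N N).
rewrite (prod_lt (fun t => q ^+ (6 * t + 5) * (1 + q ^+ (2 * t + 1)))) ?(ltnW lN) //.
congr (_ * _ * _ * _).
  rewrite big_split /=; congr (_ * _).
  elim: {lN}l => [|l IH]; first by rewrite big_ord0 expr0.
  by rewrite big_ord_recr /= IH -exprD; congr (q ^+ _); nia.
case: (ltnP (2 * l) N) => lN2.
  rewrite (bigD1 (Ordinal lN2)) //= eqxx big1 => [|t tl]; last by rewrite ifN.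
  by rewrite mulr1; congr (1 - q ^+ _); lia.
(* Here the forbidden part is beyond the range of the product, but its power of [q] is zero. *)
rewrite (expr_nilpotent qN (m := 4 * l + 2)); last by lia.
rewrite subr0 big1 // => t _; rewrite ifN //; have := ltn_ord t; lia.
Qed.

(** * The classes Prdo and Aset *)

Lemma admissibleP (c : nat -> nat -> bool) m s :
  reflect (forall i, (0 < i <= m)%N -> c i (count_mem i s)) (admissible c m s).
Proof.
apply: (iffP allP) => H i; last by rewrite mem_iota add1n ltnS; apply: H.
by move=> im; apply: H; rewrite mem_iota add1n ltnS.
Qed.

Lemma last_partition s : is_partition s -> s != [::] ->
  (smallest_part s \in s) /\ (forall x, x \in s -> (smallest_part s <= x)%N).
Proof.
case: s => // y s /andP[/= s_sorted _] _; rewrite /smallest_part /=; split.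
  exact: mem_last.
move=> x; rewrite inE => /orP[/eqP->|].
  elim: s y s_sorted {x} => //= z s IH y /andP[zy /IH]; lia.
elim: s y s_sorted => // z s IH y /= /andP[_ zs]; rewrite inE => /orP[/eqP->|]; last exact: IH zs.
elim: s z zs {IH y x} => //= z s IH y /andP[zy /IH]; lia.
Qed.

(** The condition [condT j] freed from the bound on the parts. *)
Definition inT (s : seq nat) (j : nat) : Prop :=
  (forall i, odd i -> (count_mem i s <= (2 * j + 3 <= i))%N) /\
  (forall i, (0 < i <= j)%N -> (2 * i)%N \in s).

Lemma inT_lt s j i : inT s j -> odd i -> i \in s -> (2 * j + 3 <= i)%N.
Proof.
move=> [H _] /H; rewrite -has_pred1 has_count.
by case: leqP => //=; lia.
Qed.

(** The segment of valid [j] ends at an even index. Start (1) with parameter j ends it at 2j - 2,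
    because 4j - 1 occurs; start (2) ends it at 2j, because 4j + 2 is missing; without the part 2 it
    ends at 0. *)
Lemma Prdo_inT s : is_partition s ->
  Prdo s <-> exists j, inT s (2 * j) /\ ~ inT s (2 * j + 1).
Proof.
move=> sp; have [->|s0] := eqVneq s [::].
  split => // _; exists 0; split; first by split => // i; case: i.
  by case=> _ /(_ 1 isT).
have [min_in min_le] := last_partition sp s0.
have odd_cnt : all (fun x => odd x ==> (count_mem x s <= 1)%N) s ->
    forall k, (forall x, x \in s -> odd x -> (k <= x)%N) ->
    forall i, odd i -> (count_mem i s <= (k <= i))%N.
  move=> /allP s1 k ks i oi; case: (boolP (i \in s)) => [i_s|/count_memPn-> //].
  by rewrite (ks i i_s oi); have := s1 i i_s; rewrite oi.
rewrite /Prdo s0 /=; split.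
  move=> /and3P[s1 min1 start].
  have [min2|min2] := eqVneq (smallest_part s) 2; last first.
    exists 0; split; last first.
      by case=> _ /(_ 1 isT) /min_le; lia.
    split=> [|[]//]; apply: odd_cnt => // x /min_le; lia.
  move: start; rewrite min2 eqxx => /rdo_startP[j j0].
  case=> /and3P[/allP evens + /allP odds].
    move=> /eqP c1; exists j.-1; split; last first.
      move=> Tj; have := inT_lt Tj (i := (4 * j - 1)%N); rewrite -has_pred1 has_count c1; lia.
    split=> [|i i_le]; last by apply: evens; rewrite mem_iota; lia.
    apply: odd_cnt => // x /odds + ox; rewrite ox /=; lia.
  move=> ns; exists j; split; last first.
    case=> _ /(_ (2 * j + 1)%N); rewrite (_ : (2 * (2 * j + 1) = 4 * j + 2)%N) ?(negPf ns); lia.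
  split=> [|i i_le]; last by apply: evens; rewrite mem_iota; lia.
  apply: odd_cnt => // x /odds + ox; rewrite ox /=; lia.
case=> j [Tj nTj]; have [odds evens] := Tj.
have min1 : (1 < smallest_part s)%N.
  have : smallest_part s != 0 by apply: contraTneq min_in => ->; case/andP: sp.
  have : smallest_part s != 1; last by lia.
  by apply/eqP => min1; have := inT_lt Tj _ min_in; rewrite min1; lia.
apply/and3P; split => //.
  by apply/allP => x _; apply/implyP => /odds; case: (_ <= x)%N => /=; lia.
apply/implyP => /eqP min2; apply/rdo_startP.
have evensP k : (k <= 2 * j)%N -> all (fun i => (2 * i)%N \in s) (iota 1 k).
  by move=> kj; apply/allP => i; rewrite mem_iota => i_k; apply: evens; lia.
(* If [4 * j + 2] is missing, this is start (2). Otherwise only an occurrence of [4 * j + 3] can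
   make [inT s (2 * j + 1)] fail, and this is start (1) with [j.+1]. *)
have [in2|nin2] := boolP ((4 * j + 2)%N \in s); last first.
  exists j; last first.
    right; apply/and3P; split => //; first exact: evensP.
    apply/allP => x xs; apply/implyP => ox; have := inT_lt Tj ox xs; lia.
  case: (posnP j) nin2 => // ->; rewrite muln0 add0n -min2 min_in //.
have in3 : (4 * j + 3)%N \in s.
  apply: contra_notT nTj => nin3; split=> [i oi|i i_le].
    have := odds i oi; have [->|i3] := eqVneq i (4 * j + 3)%N.
      by rewrite (count_memPn nin3).
    by rewrite (_ : (2 * (2 * j) + 3 <= i)%N = (2 * (2 * j + 1) + 3 <= i)%N) //; lia.
  have [i2|i2] := leqP i (2 * j); first by apply: evens; lia.
  by rewrite (_ : (2 * i = 4 * j + 2)%N); lia.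
exists j.+1 => //; left; apply/and3P; split.
- apply/allP => i; rewrite mem_iota => i_le.
  have [i2|i2] := leqP i (2 * j); first by apply: evens; lia.
  by rewrite (_ : (2 * i = 4 * j + 2)%N); lia.
- rewrite (_ : (4 * j.+1 - 1 = 4 * j + 3)%N); last lia.
  have := odds (4 * j + 3)%N; move: in3; rewrite -has_pred1 has_count; case: leqP => /=; lia.
apply/allP => x xs; apply/implyP => ox; have := inT_lt Tj ox xs; lia.
Qed.

Lemma sum_sign_lt (R : pzRingType) r N : (r <= N)%N ->
  \sum_(j < N) (-1) ^+ j * (j < r)%:R = (odd r)%:R :> R.
Proof.
move=> rN; transitivity (\sum_(j < r) (-1) ^+ j : R).
  rewrite (big_ord_widen N (fun j => (-1) ^+ j)) // [RHS]big_mkcond.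
  by apply: eq_bigr => j _; case: ltnP; rewrite ?mulr1 ?mulr0.
elim: r {rN} => [|r IH]; first by rewrite big_ord0.
by rewrite big_ord_recr IH /= -signr_odd; case: odd; rewrite ?subrr ?add0r ?expr0 ?expr1 ?subrr.
Qed.

Lemma partitions_le_facts m n s : s \in partitions_le m n ->
  is_partition s /\ forall x, x \in s -> (0 < x)%N && (x <= m)%N && (x <= n)%N.
Proof.
move=> sm; have := sm; rewrite mem_partitions_le => /and3P[sp /allP s_le sn].
split=> // x xs; rewrite s_le // andbT lt0n; apply/andP; split.
  by apply: contraTneq xs => ->; case/andP: sp.
have : s \in partitions n by rewrite mem_partitions sp.
by rewrite mem_partitions_le => /and3P[_ /allP/(_ x xs)].
Qed.

Lemma Prdo_sum s n N : (n < N)%N -> s \in partitions_le (2 * N) n ->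
  (Prdo s)%:R =
  \sum_(j < N) (-1) ^+ j * (admissible (condT j) (2 * N) s)%:R :> rat.
Proof.
move=> nN /partitions_le_facts[sp s_le].
pose T j := admissible (condT j) (2 * N) s.
have TP j : (j <= N)%N -> reflect (inT s j) (T j).
  move=> jN; apply: (iffP (admissibleP _ _ _)) => [H|[odds evens] i iN].
    split=> [i oi|i ij].
      case: (boolP (i \in s)) => [/s_le i_le|/count_memPn-> //].
      by have := H i; rewrite /condT oi; apply; lia.
    have := H (2 * i)%N; rewrite /condT oddM /= -has_pred1 has_count.
    rewrite (_ : (2 * i <= 2 * j)%N); last lia.
    by apply; lia.
  rewrite /condT; case: ifP => [/odds //|/negbT ei].
  case: (leqP i (2 * j)) => //= ij; rewrite -has_count has_pred1.
  by rewrite (_ : i = 2 * i./2)%N; [apply: evens | ]; lia.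
have T_dec j : T j.+1 -> T j.
  move=> /admissibleP H; apply/admissibleP => i /H; rewrite /condT.
  by case: (odd i); lia.
(* [T N] would require the part [2 * N], which exceeds [n]. So the segment has a length [r <= N],
   and [Prdo] amounts to [r] being odd. *)
have nTN : ~~ T N.
  apply/negP => /(TP _ (leqnn N)) [_ H].
  have /s_le : (2 * N)%N \in s; first apply: H; lia.
case: (ex_minnP (ex_intro (fun j => ~~ T j) N nTN)) => r nTr r_min.
have rN := r_min N nTN.
have TE j : T j = (j < r)%N.
  apply/idP/idP => [Tj|]; last by apply: contraLR => /r_min; lia.
  rewrite ltnNge; apply: contra nTr => rj.
  by rewrite -(subnKC rj) in Tj; elim: (j - r)%N Tj => [|d IH]; rewrite ?addn0 // addnS => /T_dec.
under eq_bigr do rewrite -/(T _) TE.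
rewrite sum_sign_lt //; congr (nat_of_bool _)%:R; apply/idP/idP.
  case/(Prdo_inT sp) => j [Tj nTj].
  have jN : (2 * j < N)%N.
    have [->|j0] := posnP j; first lia.
    by case: Tj => _ H; have /s_le := H (2 * j)%N ltac:(lia); lia.
  move/(TP _ (ltnW jN)): Tj; move/TP: nTj => /(_ ltac:(lia)).
  rewrite !TE => r1 r2; have -> : r = (2 * j).+1 by lia.
  by rewrite oddS oddM.
move=> or; apply/(Prdo_inT sp); exists r./2; split.
  by apply/TP; rewrite ?TE; lia.
by apply/TP; rewrite ?TE; lia.
Qed.

(** * The class [Aset], split according to the mex *)

Lemma mexP s : [/\ (0 < mex s)%N, mex s \notin s &
  forall i, (0 < i < mex s)%N -> i \in s].
Proof.
rewrite /mex; case: ex_minnP => m /andP[m0 ms] m_min; split=> // i /andP[i0 im].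
by apply: contraLR im => is_; rewrite -leqNgt; apply: m_min; rewrite i0.
Qed.

Lemma admissible_condA s n N l : (n < N)%N -> s \in partitions_le (2 * N) n ->
  (l < N)%N -> admissible (condA l) (2 * N) s = Aset s && (mex s == 2 * l + 1)%N.
Proof.
move=> nN /partitions_le_facts[_ s_le] lN; have [m0 ms m_min] := mexP s.
apply/admissibleP/andP => [H|[/and5P[om ns ev od big] /eqP em] i iN].
  have em : mex s = (2 * l + 1)%N.
    apply/eqP; rewrite eqn_leq; apply/andP; split; rewrite leqNgt.
      apply/negP => lt_m; have : (2 * l + 1)%N \in s by apply: m_min; lia.
      rewrite -has_pred1 has_count.
      have := H (2 * l + 1)%N; rewrite /condA oddD oddM /= ltnn; lia.
    apply/negP => m_lt; move: ms; rewrite -has_pred1 has_count.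
    have := H (mex s); rewrite /condA m_lt; case: ifP; lia.
  split; last exact/eqP.
  apply/and5P; rewrite em; split; first by rewrite oddD oddM.
  - apply/negP => /[dup] /s_le; rewrite -has_pred1 has_count.
    have := H (2 * (2 * l + 1))%N; rewrite /condA oddM /= ifN; last by lia.
    rewrite (_ : (_ == _)); lia.
  - apply/allP => i; rewrite mem_iota => i_le; apply/implyP => ei.
    by have := H i; rewrite /condA (negPf ei) ifT; [apply | ]; lia.
  - apply/allP => i; rewrite mem_iota => i_le; apply/implyP => oi.
    by have := H i; rewrite /condA oi ifT; lia.
  apply/allP => i is_; apply/implyP => /andP[oi mi].
  have := H i; rewrite /condA oi ifN ?mi; last lia.
  by apply; have := s_le i is_; lia.
move: ns ms ev od big; rewrite em => ns ms /allP ev /allP od /allP big.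
have cnt j : (j < 2 * l + 1)%N -> (0 < j)%N -> (0 < count_mem j s)%N.
  by move=> j1 j2; rewrite -has_count has_pred1; apply: m_min; lia.
rewrite /condA; case: ifP => oi; case: ltnP => il.
- have := od i; rewrite mem_iota oi /= cnt; lia.
- have [->|i_neq] := eqVneq i (2 * l + 1)%N; first by rewrite (count_memPn ms).
  have -> : (2 * l + 1 < i)%N by lia.
  case: (boolP (i \in s)) => [/[dup] is_ /big|/count_memPn-> //].
  by rewrite oi /=; lia.
- have := ev i; rewrite mem_iota oi /=; lia.
apply/implyP => /eqP ei; apply/eqP/count_memPn.
by move: ns; rewrite (_ : (2 * (2 * l + 1) = i)%N) //; lia.
Qed.

Lemma Aset_sum s n N : (n < N)%N -> s \in partitions_le (2 * N) n ->
  (Aset s)%:R = \sum_(l < N) (admissible (condA l) (2 * N) s)%:R :> rat.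
Proof.
move=> nN sn.
under eq_bigr do rewrite (admissible_condA nN sn) //.
case As : (Aset s); last by rewrite big1.
have [m0 ms m_min] := mexP s.
have [_ s_le] := partitions_le_facts sn.
have om : odd (mex s) by case/and5P: As.
(* The only contributing index is in range: if the mex exceeds 1, its predecessor is a part, hence
   at most [n]. *)
have lN : ((mex s)./2 < N)%N.
  have [|m1] := leqP (mex s) 1; first by lia.
  have /s_le : (mex s).-1 \in s; first apply: m_min; lia.
rewrite (bigD1 (Ordinal lN)) //= big1 ?addr0 => [|l].
  by rewrite (_ : mex s == _) //; lia.
by rewrite -val_eqE /= => l_neq; rewrite (_ : (mex s == _) = false) //; lia.
Qed.

Lemma gen_fun_sum (P : pred (seq nat)) (c : nat -> nat -> nat -> bool)
    (a : nat -> rat) n N : (n < N)%N ->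
  (forall s, s \in partitions_le (2 * N) n -> (P s)%:R =
     \sum_(j < N) a j * (admissible (c j) (2 * N) s)%:R :> rat) ->
  gen_fun P (fun=> 1) n =
  (\sum_(j < N) (a j)%:P * mult_gf (c j) N.+3 (2 * N) 'X)`_n.
Proof.
move=> nN Pc; rewrite /gen_fun (perm_big _ (perm_partitions_le (_ : n <= 2 * N)%N)); last lia.
rewrite big_mkcond coef_sum.
transitivity (\sum_(s <- partitions_le (2 * N) n)
    \sum_(j < N) a j * (admissible (c j) (2 * N) s)%:R).
  by apply: eq_big_seq => s /Pc <-; case: (P s).
rewrite exchange_big; apply: eq_bigr => j _.
rewrite coefCM -coef_mult_gf; last by lia.
rewrite -mulr_sumr [in RHS]big_mkcond; congr (_ * _).
by apply: eq_bigr => s _; case: admissible.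
Qed.

Lemma gen_fun_Prdo n N : (n < N)%N -> gen_fun Prdo (fun=> 1) n =
  (\sum_(j < N) ((-1) ^+ j)%:P * mult_gf (condT j) N.+3 (2 * N) 'X)`_n.
Proof. by move=> nN; apply: gen_fun_sum => // s; apply: Prdo_sum. Qed.

Lemma gen_fun_Aset n N : (n < N)%N -> gen_fun Aset (fun=> 1) n =
  (\sum_(l < N) 1%:P * mult_gf (condA l) N.+3 (2 * N) 'X)`_n.
Proof.
move=> nN; apply: (gen_fun_sum (a := fun=> 1)) => // s sn.
by rewrite (Aset_sum nN sn); apply: eq_bigr => l _; rewrite mul1r.
Qed.

(** * The weighted sum over GG2 *)

(* The pair (d, a) encodes a part lambda_i that is even iff d holds and whose
   factor in omega2 is a + 1. *)
Fixpoint decode (l : seq (bool * nat)) : seq nat :=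
  if l is (d, a) :: t then
    let r := decode t in
    (head 0 r + ~~ odd (head 0 r) + d + 2 * a.+1)%N :: r
  else [::].

Definition code_weight (l : seq (bool * nat)) : nat := \prod_(p <- l) p.2.+1.

Definition code_height (l : seq (bool * nat)) : nat :=
  \sum_(p <- l) 2 * (p.1 + p.2.+1).

(** A letter [(d, a)] raises the largest part plus its evenness correction by [2 * (d + a.+1)],
    starting from 1 for the empty list. The value is therefore odd, which makes [d] the evenness of
    the next part. *)
Lemma head_decode l :
  (head 0 (decode l) + ~~ odd (head 0 (decode l)))%N = (code_height l).+1.
Proof.
elim: l => [|[d a] t IH]; first by rewrite /code_height big_nil.
rewrite /code_height big_cons -/(code_height t) /= IH.
by case: d; lia.
Qed.

(** States that every factor of [omega2] is at least 1. The default head 0 counts as even, which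
    forces the smallest part to be at least 3. *)
Fixpoint gg_gaps (s : seq nat) : bool :=
  if s is x :: r then
    (head 0 r + ~~ odd (head 0 r) + ~~ odd x + 2 <= x)%N && gg_gaps r
  else true.

Lemma partition_cons x r : is_partition (x :: r) =
  [&& (0 < x)%N, (head 0 r <= x)%N & is_partition r].
Proof.
rewrite /is_partition inE negb_or eq_sym -lt0n andbCA; congr (_ && _).
by case: r => //= y r; rewrite -andbA.
Qed.

Lemma partition_head s y : is_partition s -> y \in s -> (y <= head 0 s)%N.
Proof.
case/andP; case: s => // x r /= /order_path_min xr _; rewrite inE.
case/orP => [/eqP-> //|]; apply: (allP (xr _)).
by move=> a b c /= ab bc; exact: leq_trans bc ab.
Qed.

Lemma gg_gapsE s : gg_gaps s = is_partition s && GG2 s.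
Proof.
elim: s => // x r IH; rewrite /= IH; apply/andP/andP.
  case=> gap /andP[rp /and3P[r3 r2 re]].
  have x_gt y : y \in r -> (y <= head 0 r)%N by exact: partition_head.
  split; first by rewrite partition_cons rp andbT; lia.
  apply/and3P; split.
  - by rewrite /= r3 andbT; lia.
  - by case: (r) r2 gap => //= y r' ->; rewrite andbT; lia.
  apply/allP => y; rewrite inE => /orP[/eqP->|yr]; apply/implyP => ey.
    by rewrite inE negb_or; apply/andP; split; [|apply/negP => /x_gt]; lia.
  rewrite inE negb_or; apply/andP; split; last by have := allP re y yr; rewrite ey.
  (* An even part equal to [x - 2] would be the next part or lie below it; the gap condition
     excludes both. *)
  apply/eqP => exy; have y_le := x_gt y yr.
  have [ey2|ney] := eqVneq y (head 0 r); first by move: gap; rewrite -ey2; lia.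
  lia.
rewrite partition_cons => -[/and3P[x0 hx rp]] /and3P[/= /andP[x3 r3] r2 /andP[xe re]].
split.
  case: r r2 hx re {IH rp r3 xe} => [|y r] /=; first lia.
  case/andP => xy _ _ /andP[ye _]; move: ye.
  by rewrite inE negb_or /=; lia.
rewrite rp /= /GG2 r3 (path_sorted r2) /=.
apply: sub_all re => y; case: (odd y) => //=.
by rewrite inE negb_or => /andP[].
Qed.

Lemma gg_gaps_decode l : gg_gaps (decode l).
Proof.
elim: l => // -[d a] t IH /=; rewrite IH andbT.
by have := head_decode t; case: d; lia.
Qed.

Lemma decode_inj : injective decode.
Proof.
elim=> [|[d a] t IH] [|[d' a'] t'] //= [eh /IH et]; rewrite -et in eh *.
have ed : d = d'.
  by have := head_decode t; case: d eh; case: d' => //=; lia.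
by rewrite ed in eh *; congr ((_, _) :: _); lia.
Qed.

Lemma decode_surj s : gg_gaps s -> exists l, decode l = s.
Proof.
elim: s => [|x r IH /=]; first by exists [::].
case/andP => gap /IH[l el].
pose d := ~~ odd x; pose y := (x - (head 0 r + ~~ odd (head 0 r)) - d)%N.
exists ((d, y./2.-1) :: l); rewrite /= el; congr (_ :: _).
have : odd (head 0 r + ~~ odd (head 0 r)) by rewrite oddD; case: (odd _).
by move: gap; rewrite /y /d; set h := (head 0 r + ~~ odd _)%N; lia.
Qed.

Lemma omega2_cons x r : omega2 (x :: r) =
  (x%:R - (head 0%N r)%:R - (~~ odd x)%:R - (~~ odd (head 0%N r))%:R) / 2 * omega2 r.
Proof. by rewrite /omega2 big_ord_recl /= nth0. Qed.

Lemma omega2_decode l : omega2 (decode l) = (code_weight l)%:R.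
Proof.
elim: l => [|[d a] t IH]; first by rewrite /omega2 big_ord0 /code_weight big_nil.
rewrite omega2_cons IH /code_weight big_cons natrM -/(code_weight t).
congr (_ * _); set h := head 0%N _; set x := (h + _ + _ + _)%N.
have -> : ~~ odd x = d.
  by have := head_decode t; rewrite -/h /x; case: (d); lia.
rewrite /x !natrD natrM.
by field.
Qed.

(** * Enumeration of the codes and their generating function *)

Definition code_letters (L : nat) : seq (bool * nat) :=
  [seq (d, a) | d <- [:: false; true], a <- iota 0 L].

Fixpoint codes (L k : nat) : seq (seq (bool * nat)) :=
  if k is k'.+1 then [seq p :: t | p <- code_letters L, t <- codes L k']
  else [:: [::]].

Lemma mem_code_letters L p : (p \in code_letters L) = (p.2 < L)%N.
Proof.
apply/allpairsP/idP => [[[d a] /= [_ + ->]]|]; first by rewrite mem_iota.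
by case: p => d a /= aL; exists (d, a); rewrite mem_iota /=; case: d.
Qed.

Lemma mem_codes L k l :
  (l \in codes L k) = (size l == k) && all (fun p => p.2 < L)%N l.
Proof.
elim: k l => [|k IH] [|p t]; rewrite //=.
  by apply/allpairsP => -[[? ?] [_ _ ]].
rewrite eqSS andbCA -IH -mem_code_letters; apply/allpairsP/andP.
  by case=> -[p' t'] /= [p_in t_in [-> ->]].
by case=> p_in t_in; exists (p, t).
Qed.

Lemma uniq_codes L k : uniq (codes L k).
Proof.
elim: k => // k IH; apply: allpairs_uniq => //; last by case=> [? ?] [? ?] _ _ [-> ->].
by apply: allpairs_uniq; rewrite ?iota_uniq //; case=> [? ?] [? ?] _ _ [-> ->].
Qed.

Definition code_gf (K : comNzRingType) L (q : K) : K :=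
  \sum_(k < L) \sum_(l <- codes L k) (code_weight l)%:R * q ^+ sumn (decode l).

Lemma rmorph_code_gf (K K' : comNzRingType) (f : {rmorphism K -> K'}) L q :
  f (code_gf L q) = code_gf L (f q).
Proof.
rewrite rmorph_sum; apply: eq_bigr => k _; rewrite rmorph_sum.
by apply: eq_bigr => l _; rewrite rmorphM rmorph_nat rmorphXn.
Qed.

(** Bounding both the length and the entries of codes by [N] loses nothing: for a code of a
    partition of [n], both the length and [code_height] are at most [n]. *)
Lemma perm_GG2_codes n N : (n < N)%N ->
  perm_eq [seq s <- partitions n | GG2 s]
    [seq decode l | l <- [seq l <- [seq l | k <- iota 0 N, l <- codes N k]
                        | sumn (decode l) == n]].
Proof.
move=> nN; apply: uniq_perm.
- exact/filter_uniq/uniq_partitions.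
- rewrite map_inj_uniq; last exact: decode_inj.
  apply/filter_uniq/allpairs_uniq_dep => [|k _|]; rewrite ?iota_uniq ?uniq_codes //.
  move=> _ _ /allpairsPdep[k [l [_ + ->]]] /allpairsPdep[k' [l' [_ + ->]]] /= el.
  by rewrite -el !mem_codes => /andP[/eqP<- _] /andP[/eqP<- _].
move=> s; rewrite mem_filter mem_partitions; apply/andP/mapP.
  case=> sg /andP[sp sn].
  have /decode_surj[l el] : gg_gaps s by rewrite gg_gapsE sp.
  exists l => //; rewrite mem_filter el sn; apply/allpairsPdep; exists (size l), l.
  have sz t : (2 * size t + code_height t <= 2 * (sumn (decode t)))%N.
    elim: t => [|[d a] t IH]; first by rewrite /code_height big_nil.
    have := head_decode t; rewrite /code_height big_cons -/(code_height t) /=; lia.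
  have ht t p : p \in t -> (p.2 < code_height t)%N.
    elim: t => // -[d a] t IH; rewrite inE /code_height big_cons -/(code_height t).
    by case/orP => [/eqP->|/IH] /=; lia.
  have st : (code_height l <= sumn (decode l))%N.
    case: (l) => [|[d a] t]; first by rewrite /code_height big_nil.
    have := head_decode t; rewrite /code_height big_cons -/(code_height t) /=; lia.
  have := sz l; rewrite el (eqP sn) in st * => szl; split=> //.
    by rewrite mem_iota; lia.
  by rewrite mem_codes eqxx; apply/allP => p /ht; lia.
case=> l; rewrite mem_filter => /andP[ln _] ->; split.
  by have := gg_gaps_decode l; rewrite gg_gapsE => /andP[].
by have := gg_gaps_decode l; rewrite gg_gapsE ln => /andP[->].
Qed.

Lemma sum_iota0 (V : nmodType) n (F : nat -> V) :
  \sum_(i <- iota 0 n) F i = \sum_(i < n) F i.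
Proof. by rewrite -(big_mkord xpredT) /index_iota subn0. Qed.

Lemma gen_fun_GG2 n N : (n < N)%N ->
  gen_fun GG2 omega2 n = (code_gf N ('X : {poly rat}))`_n.
Proof.
move=> nN; rewrite /gen_fun -big_filter (perm_big _ (perm_GG2_codes nN)).
rewrite big_map big_filter big_mkcond big_allpairs_dep /code_gf coef_sum.
rewrite (sum_iota0 N (fun k => \sum_(l <- codes N k) _)).
apply: eq_bigr => k _; rewrite coef_sum; apply: eq_bigr => l _.
rewrite omega2_decode mulr_natl coefMn coefXn eq_sym.
by case: (n == _); rewrite ?mul0rn.
Qed.

(** Prepending a letter adds a part containing the whole height of the tail, so the height weight of
    the tail rises from [j] to [j.+1]. Hence the general [j], and the sum factors letter by
    letter. *)
Lemma code_gf_prod (K : comNzRingType) L k j (q : K) :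
  \sum_(l <- codes L k)
     (code_weight l)%:R * q ^+ (sumn (decode l) + j * code_height l) =
  \prod_(i < k) \sum_(p <- code_letters L)
     p.2.+1%:R * q ^+ (1 + p.1 + 2 * p.2.+1 + (j + i) * (2 * (p.1 + p.2.+1))).
Proof.
elim: k j => [|k IH] j.
  by rewrite big_ord0 big_seq1 /code_weight /code_height !big_nil muln0 expr0 mulr1.
rewrite big_ord_recl big_allpairs_dep /= mulr_suml; apply: eq_bigr => -[d a] _ /=.
have -> : \prod_(i < k) \sum_(p <- code_letters L) p.2.+1%:R *
    q ^+ (1 + p.1 + 2 * p.2.+1 + (j + bump 0 i) * (2 * (p.1 + p.2.+1))) =
  \sum_(l <- codes L k)
     (code_weight l)%:R * q ^+ (sumn (decode l) + j.+1 * code_height l).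
  rewrite IH; apply: eq_bigr => i _; apply: eq_bigr => p _.
  by rewrite /bump leq0n add1n (addnS j).
rewrite mulr_sumr; apply: eq_bigr => t _.
have := head_decode t; rewrite /code_weight /code_height !big_cons.
rewrite -/(code_weight t) -/(code_height t) /= natrM => ->.
rewrite mulrACA -exprD; congr (_ * q ^+ _); lia.
Qed.

Section CodeSeries.

Variables (K : comNzRingType) (q : K) (N : nat).
Hypothesis qN : q ^+ N = 0.

Lemma geo_sqr i : (0 < i)%N ->
  \sum_(a < N) a.+1%:R * q ^+ (i * a) = geo q N i ^+ 2.
Proof.
move=> i0; rewrite expr2; apply: (geo_unique qN) => //.
have H n : (\sum_(a < n) a.+1%:R * q ^+ (i * a)) * (1 - q ^+ i) =
    \sum_(a < n) q ^+ (i * a) - n%:R * q ^+ (i * n).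
  elim: n => [|n IH]; first by rewrite !big_ord0 !mul0r subrr.
  by rewrite !big_ord_recr /= mulrDl IH mulnS exprD -(natr1 n); ring.
by rewrite H (expr_nilpotent qN (m := i * N)) ?mulr0 ?subr0 //; nia.
Qed.

Lemma code_gf_ggL : code_gf N q = ggL q N 0.
Proof.
rewrite /code_gf /ggL; apply: eq_bigr => k _.
transitivity (\sum_(l <- codes N k)
     (code_weight l)%:R * q ^+ (sumn (decode l) + 0 * code_height l)).
  by apply: eq_bigr => l _; rewrite mul0n addn0.
rewrite code_gf_prod.
(* Summing over [d] gives [1 + q ^+ (2 * i + 1)]; summing over [a] with weight [a.+1] gives the
   square of a geometric series. *)
transitivity (\prod_(i < k) (q ^+ (2 * i + 3) * (1 + q ^+ (2 * i + 1)) *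
   geo q N (2 * i + 2) * geo q N (2 * i + 2))).
  apply: eq_bigr => i _; rewrite -mulrA -expr2 -geo_sqr; last by lia.
  rewrite big_allpairs_dep /= big_cons big_seq1 !sum_iota0 mulr_sumr -big_split.
  apply: eq_bigr => a _ /=; rewrite add0n.
  have -> : (1 + 0 + 2 * a.+1 + i * (2 * (0 + a.+1)) = (2 * i + 3) + (2 * i + 2) * a)%N by nia.
  have -> : (1 + 1 + 2 * a.+1 + i * (2 * (1 + a.+1)) = (2 * i + 1) + (2 * i + 3) + (2 * i + 2) * a)%N by nia.
  by rewrite !(exprD _ _ ((2 * i + 2) * a)) (exprD _ _ (2 * i + 3)); ring.
rewrite !big_split /= -/(oddP q k) -/(invE q N k) /gg_term addn0.
have -> : \prod_(i < k) q ^+ (2 * i + 3) = q ^+ (k * k + 2 * 0 * k) * q ^+ (2 * k).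
  rewrite -exprD; elim: (nat_of_ord k) => [|m IH]; first by rewrite big_ord0 expr0.
  by rewrite big_ord_recr /= IH -exprD; congr (q ^+ _); nia.
by ring.
Qed.

End CodeSeries.

Theorem theorem3p6 :
  (gen_fun GG2 omega2 =1 gen_fun Prdo (fun _ => 1%R)) /\
  (gen_fun Prdo (fun _ => 1%R) =1 gen_fun Aset (fun _ => 1%R)).
Proof.
have sumPrdo N (q := in_qpoly 'X^N ('X : {poly rat})) : q ^+ N = 0 ->
    in_qpoly 'X^N (\sum_(j < N) ((-1) ^+ j)%:P * mult_gf (condT j) N.+3 (2 * N) 'X) =
    \sum_(j < N) (-1) ^+ j * q ^+ (j * j.+1) * oddT q N j.+1 * invE q N N.
  move=> qN; rewrite rmorph_sum; apply: eq_bigr => j _.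
  rewrite rmorphM rmorph_mult_gf (mult_gf_condT qN (ltnW (ltn_ord j))).
  by rewrite !rmorphXn !rmorphN1 !mulrA.
have main n : gen_fun GG2 omega2 n = gen_fun Prdo (fun=> 1) n /\
    gen_fun Prdo (fun=> 1) n = gen_fun Aset (fun=> 1) n.
  have [N nN] : exists N, (n < N)%N by exists n.+1.
  have qN := in_qpoly_Xn_nilpotent rat (leq_ltn_trans (leq0n n) nN).
  rewrite (gen_fun_GG2 nN) (gen_fun_Prdo nN) (gen_fun_Aset nN).
  split; apply: (in_qpoly_Xn_eq nN); rewrite sumPrdo //.
    by rewrite rmorph_code_gf code_gf_ggL ?ggL_sum.
  rewrite rogers_false_theta // rmorph_sum; apply: eq_bigr => l _.
  by rewrite mul1r rmorph_mult_gf mult_gf_condA.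
by split=> n; have [] := main n.
Qed.
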